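(* Let $(\mathcal{C},\mathbb{E},\mathfrak{s})$ be an extriangulated category with enough projectives and enough injectives. The assignments $$(\mathcal{X},\mathcal{W})\mapsto(\mathcal{X},\widehat{\mathcal{W}})\quad\text{and}\quad(\mathcal{U},\mathcal{V})\mapsto(\mathcal{U},\mathcal{U}\cap\mathcal{V})$$ give mutually inverse bijections between the following classes: (1) Left Frobenius pairs $(\mathcal{X},\mathcal{W})$ in $\mathcal{C}$. (2) Cotorsion pairs $(\mathcal{U},\mathcal{V})$ on the extriangulated category $\mathrm{Thick}(\mathcal{U})$ with $\mathcal{V}\subseteq\mathcal{U}^{\perp}$.
   Context: Extriangulated categories (Nakaoka–Palu). Let $\mathcal{C}$ be an additive category and $\mathbb{E}:\mathcal{C}^{\mathrm{op}}\times\mathcal{C}\to\mathrm{Ab}$ an additive bifunctor. An element $\delta\in\mathbb{E}(C,A)$ is an $\mathbb{E}$-extension; write $a_*\delta=\mathbb{E}(C,a)(\delta)$ and $c^*\delta=\mathbb{E}(c,A)(\delta)$. Two sequences $A\to B\to C$ and $A\to B'\to C$ are equivalent if there is an isomorphism $B\to B'$ compatible with $\mathrm{id}_A,\mathrm{id}_C$. A realization $\mathfrak{s}$ assigns to each $\delta\in\mathbb{E}(C,A)$ an equivalence class $\mathfrak{s}(\delta)=[A\xrightarrow{x}B\xrightarrow{y}C]$ such that, if $\mathfrak{s}(\delta')=[A'\xrightarrow{x'}B'\xrightarrow{y'}C']$ and $a:A\to A'$, $c:C\to C'$ satisfy $a_*\delta=c^*\delta'$, then there is $b:B\to B'$ with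 $bx=x'a$, $y'b=cy$. It is additive if $\mathfrak{s}(0)$ is the class of the split sequence $A\to A\oplus C\to C$ and $\mathfrak{s}(\delta\oplus\delta')=\mathfrak{s}(\delta)\oplus\mathfrak{s}(\delta')$. The triple $(\mathcal{C},\mathbb{E},\mathfrak{s})$ is extriangulated if $\mathfrak{s}$ is an additive realization and the following hold. (ET3): if $\delta,\delta'$ are realized by $A\xrightarrow{x}B\xrightarrow{y}C$ and $A'\xrightarrow{x'}B'\xrightarrow{y'}C'$ and $bx=x'a$, then there is $c$ with $cy=y'b$ and $a_*\delta=c^*\delta'$. (ET3)$^{\mathrm{op}}$: the dual. (ET4): if $\delta\in\mathbb{E}(D,A)$ and $\delta'\in\mathbb{E}(F,B)$ are realized by $A\xrightarrow{f}B\xrightarrow{f'}D$ and $B\xrightarrow{g}C\xrightarrow{g'}F$, then there are an object $E$, morphisms $h':C\to E$, $d:D\to E$, $e:E\to F$ with $h'g=df'$, $eh'=g'$, and $\delta''\in\mathbb{E}(E,A)$ realized by $A\xrightarrow{gf}C\xrightarrow{h'}E$, such that $D\xrightarrow{d}E\xrightarrow{e}F$ realizes $f'_*\delta'$, $d^*\delta''=\delta$ and $f_*\delta''=e^*\delta'$. (ET4)$^{\mathrm{op}}$: the dual. A sequence $A\to B\to C$ realizing some $\delta$ is called a conflation; together with $\delta$ it is an $\mathbb{E}$-triangle; $A\to B$ is then an inflation and $B\to C$ a deflation. An object $P$ is projective if for every $\mathbb{E}$-triangle $A\to B\xrightarrow{y}C$ every morphism $P\to C$ factors through $y$; injective objects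 are dual. $\mathcal{C}$ has enough projectives (injectives) if every $C$ (every $A$) admits an $\mathbb{E}$-triangle $\Omega C\to P\to C$ with $P$ projective (resp. $A\to I\to\Sigma A$ with $I$ injective). Higher extensions: $\mathbb{E}^{i+1}(X,Y)=\mathbb{E}(\Omega^iX,Y)\cong\mathbb{E}(X,\Sigma^iY)$ for $i\ge0$. ''Subcategory'' means full additive subcategory closed under isomorphisms and direct summands. $\mathcal{X}^{\perp}=\{Y\in\mathcal{C}\mid\mathbb{E}^i(X,Y)=0\ \forall i\ge1,\ \forall X\in\mathcal{X}\}$. $\widehat{\mathcal{X}_n}$ is the class of $C\in\mathcal{C}$ admitting an $\mathbb{E}$-triangle sequence $X_n\to\cdots\to X_0\to C$ with all $X_i\in\mathcal{X}$, i.e. there are $\mathbb{E}$-triangles $K_{i+1}\to X_i\to K_i$ ($0\le i\le n-1$) with $K_0=C$, $K_n=X_n$, the maps of the sequence being the induced composites (for $n=0$: $C\in\mathcal{X}$). $\widehat{\mathcal{X}}=\bigcup_{n\ge0}\widehat{\mathcal{X}_n}$. A pair of subcategories $(\mathcal{X},\mathcal{W})$ is a left Frobenius pair in $\mathcal{C}$ if: $\mathcal{X}$ is closed under extensions (for an $\mathbb{E}$-triangle $A\to B\to C$, $A,C\in\mathcal{X}$ implies $B\in\mathcal{X}$) and under CoCone of deflations ($B,C\in\mathcal{X}$ implies $A\in\mathcal{X}$); and $\mathcal{W}$ is an $\mathcal{X}$-injective cogenerator for $\mathcal{X}$, i.e. $\mathcal{W}\subseteq\mathcal{X}$, $\mathcal{W}\subseteq\mathcal{X}^{\perp}$,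 and each $X\in\mathcal{X}$ admits an $\mathbb{E}$-triangle $X\to W\to X'$ with $W\in\mathcal{W}$, $X'\in\mathcal{X}$. A thick subcategory is one closed under direct summands such that for any $\mathbb{E}$-triangle $A\to B\to C$, if two of $A,B,C$ lie in it then so does the third. $\mathrm{Thick}(\mathcal{X})$ is the smallest thick subcategory of $\mathcal{C}$ containing $\mathcal{X}$; being closed under extensions in $\mathcal{C}$, it is an extriangulated category with the restricted structure. A cotorsion pair on an extriangulated category $\mathcal{D}$ is a pair $(\mathcal{U},\mathcal{V})$ of full additive subcategories of $\mathcal{D}$ closed under isomorphisms and direct summands such that $\mathbb{E}(U,V)=0$ for all $U\in\mathcal{U},V\in\mathcal{V}$, and each $C\in\mathcal{D}$ admits conflations $V^C\to U^C\to C$ and $C\to V_C\to U_C$ in $\mathcal{D}$ with $U^C,U_C\in\mathcal{U}$ and $V^C,V_C\in\mathcal{V}$. In (2), $\mathcal{U}^{\perp}$ is formed in $\mathcal{C}$. *)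

(* Defs.v *)
From mathcomp Require Import all_boot ssralg.
From mathcomp Require Import boolp classical_sets functions.
Set Implicit Arguments.
Unset Strict Implicit.
Unset Printing Implicit Defensive.
Local Open Scope classical_set_scope.
Local Open Scope ring_scope.

(** * Additive categories *)

Record preadditive_category := PreadditiveCategory {
  obj :> Type;
  hom : obj -> obj -> zmodType;
  idm : forall A : obj, hom A A;
  mcomp : forall A B C : obj, hom B C -> hom A B -> hom A C;
  mcompA : forall (A B C D : obj) (h : hom C D) (g : hom B C) (f : hom A B),
    mcomp h (mcomp g f) = mcomp (mcomp h g) f;
  comp1m : forall (A B : obj) (f : hom A B), mcomp (idm B) f = f;
  compm1 : forall (A B : obj) (f : hom A B), mcomp f (idm A) = f;
  compDl : forall (A B C : obj) (g g' : hom B C) (f : hom A B),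
    mcomp (g + g') f = mcomp g f + mcomp g' f;
  compDr : forall (A B C : obj) (g : hom B C) (f f' : hom A B),
    mcomp g (f + f') = mcomp g f + mcomp g f' }.

Arguments hom {p} _ _.
Arguments idm {p} A.
Arguments mcomp {p A B C} _ _.

Notation "g \oc f" := (mcomp g f) (at level 40, left associativity).

Definition is_iso (C : preadditive_category) (A B : C) (f : hom A B) : Prop :=
  exists g : hom B A, g \oc f = idm A /\ f \oc g = idm B.

Definition is_zero_obj (C : preadditive_category) (Z : C) : Prop :=
  forall A : C, (forall f : hom A Z, f = 0) /\ (forall f : hom Z A, f = 0).

Record biproduct (C : preadditive_category) (A B : C) := Biproduct {
  bobj : C;
  in1 : hom A bobj;
  in2 : hom B bobj;
  pr1 : hom bobj A;
  pr2 : hom bobj B;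
  pr1in1 : pr1 \oc in1 = idm A;
  pr2in2 : pr2 \oc in2 = idm B;
  pr1in2 : pr1 \oc in2 = 0;
  pr2in1 : pr2 \oc in1 = 0;
  inprD : in1 \oc pr1 + in2 \oc pr2 = idm bobj }.

Definition msum (C : preadditive_category) (A A' B B' : C)
    (P : biproduct A A') (Q : biproduct B B') (f : hom A B) (f' : hom A' B') :
    hom (bobj P) (bobj Q) :=
  in1 Q \oc f \oc pr1 P + in2 Q \oc f' \oc pr2 P.

Record additive_category := AdditiveCategory {
  preadd :> preadditive_category;
  zero_obj_ex : exists Z : preadd, is_zero_obj Z;
  biproduct_ex : forall A B : preadd, inhabited (biproduct A B) }.

(** * Extriangulated categories *)

(* [push a d] is a_* d and [pull c d] is c^* d. *)
Record additive_bifunctor (C : preadditive_category) := AdditiveBifunctor {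
  ext : C -> C -> zmodType;
  push : forall X A A' : C, hom A A' -> {additive ext X A -> ext X A'};
  pull : forall X X' A : C, hom X' X -> {additive ext X A -> ext X' A};
  push1 : forall (X A : C) (d : ext X A), push X (idm A) d = d;
  pull1 : forall (X A : C) (d : ext X A), pull A (idm X) d = d;
  push_comp : forall (X A A' A'' : C) (a' : hom A' A'') (a : hom A A')
    (d : ext X A), push X (a' \oc a) d = push X a' (push X a d);
  pull_comp : forall (X X' X'' A : C) (c : hom X' X) (c' : hom X'' X')
    (d : ext X A), pull A (c \oc c') d = pull A c' (pull A c d);
  pushD : forall (X A A' : C) (a a' : hom A A') (d : ext X A),
    push X (a + a') d = push X a d + push X a' d;
  pullD : forall (X X' A : C) (c c' : hom X' X) (d : ext X A),
    pull A (c + c') d = pull A c d + pull A c' d;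
  push_pull : forall (X X' A A' : C) (c : hom X' X) (a : hom A A')
    (d : ext X A), push X' a (pull A c d) = pull A' c (push X a d) }.

Arguments ext {C} _ _ _.
Arguments push {C} _ {X A A'} _.
Arguments pull {C} _ {X X' A} _.

(* The element of E(X (+) X', A (+) A') corresponding to (d, 0, 0, d'). *)
Definition ext_sum (C : preadditive_category) (E : additive_bifunctor C)
    (A A' X X' : C) (P : biproduct A A') (Q : biproduct X X')
    (d : ext E X A) (d' : ext E X' A') : ext E (bobj Q) (bobj P) :=
  push E (in1 P) (pull E (pr1 Q) d) + push E (in2 P) (pull E (pr2 Q) d').

Definition seq_equiv (C : preadditive_category) (A B B' X : C)
    (x : hom A B) (y : hom B X) (x' : hom A B') (y' : hom B' X) : Prop :=
  exists b : hom B B', [/\ is_iso b, b \oc x = x' & y' \oc b = y].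

(* [realizes x y d] says that (x, y) is a representative of the class s(d);
   [rlzE] says that the representatives of s(d) form one equivalence class. *)
Record additive_realization (C : preadditive_category)
    (E : additive_bifunctor C) := AdditiveRealization {
  realizes : forall A B X : C, hom A B -> hom B X -> ext E X A -> Prop;
  rlz_ex : forall (A X : C) (d : ext E X A),
    exists (B : C) (x : hom A B) (y : hom B X), realizes x y d;
  rlzE : forall (A B B' X : C) (x : hom A B) (y : hom B X)
      (x' : hom A B') (y' : hom B' X) (d : ext E X A),
    realizes x y d -> (realizes x' y' d <-> seq_equiv x y x' y');
  rlz_mor : forall (A B X A' B' X' : C) (x : hom A B) (y : hom B X)
      (d : ext E X A) (x' : hom A' B') (y' : hom B' X') (d' : ext E X' A')
      (a : hom A A') (c : hom X X'),
    realizes x y d -> realizes x' y' d' -> push E a d = pull E c d' ->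
    exists b : hom B B', b \oc x = x' \oc a /\ y' \oc b = c \oc y;
  rlz0 : forall (A X : C) (P : biproduct A X), realizes (in1 P) (pr2 P) 0;
  rlz_sum : forall (A B X A' B' X' : C) (x : hom A B) (y : hom B X)
      (d : ext E X A) (x' : hom A' B') (y' : hom B' X') (d' : ext E X' A')
      (PA : biproduct A A') (PB : biproduct B B') (PX : biproduct X X'),
    realizes x y d -> realizes x' y' d' ->
    realizes (msum PA PB x x') (msum PB PX y y') (ext_sum PA PX d d') }.

Section ExtriangulatedAxioms.
Variables (C : preadditive_category) (E : additive_bifunctor C).
Variable s : additive_realization E.

Definition ET3 : Prop :=
  forall (A B X A' B' X' : C) (x : hom A B) (y : hom B X) (d : ext E X A)
    (x' : hom A' B') (y' : hom B' X') (d' : ext E X' A')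
    (a : hom A A') (b : hom B B'),
  realizes s x y d -> realizes s x' y' d' -> b \oc x = x' \oc a ->
  exists c : hom X X', c \oc y = y' \oc b /\ push E a d = pull E c d'.

Definition ET3op : Prop :=
  forall (A B X A' B' X' : C) (x : hom A B) (y : hom B X) (d : ext E X A)
    (x' : hom A' B') (y' : hom B' X') (d' : ext E X' A')
    (b : hom B B') (c : hom X X'),
  realizes s x y d -> realizes s x' y' d' -> c \oc y = y' \oc b ->
  exists a : hom A A', b \oc x = x' \oc a /\ push E a d = pull E c d'.

Definition ET4 : Prop :=
  forall (A B Y D F : C) (f : hom A B) (f' : hom B D) (d1 : ext E D A)
    (g : hom B Y) (g' : hom Y F) (d2 : ext E F B),
  realizes s f f' d1 -> realizes s g g' d2 ->
  exists (Z : C) (h' : hom Y Z) (d : hom D Z) (e : hom Z F) (d3 : ext E Z A),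
    [/\ h' \oc g = d \oc f' /\ e \oc h' = g',
        realizes s (g \oc f) h' d3,
        realizes s d e (push E f' d2),
        pull E d d3 = d1 &
        push E f d3 = pull E e d2].

Definition ET4op : Prop :=
  forall (A B Y D F : C) (f : hom B A) (f' : hom D B) (d1 : ext E A D)
    (g : hom Y B) (g' : hom F Y) (d2 : ext E B F),
  realizes s f' f d1 -> realizes s g' g d2 ->
  exists (Z : C) (h' : hom Z Y) (d : hom Z D) (e : hom F Z) (d3 : ext E A Z),
    [/\ g \oc h' = f' \oc d /\ h' \oc e = g',
        realizes s h' (f \oc g) d3,
        realizes s e d (pull E f' d2),
        push E d d3 = d1 &
        pull E f d3 = push E e d2].

End ExtriangulatedAxioms.

Record extriangulated_category := ExtriangulatedCategory {
  ebase :> additive_category;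
  bif : additive_bifunctor ebase;
  rlz : additive_realization bif;
  et3 : ET3 rlz;
  et3op : ET3op rlz;
  et4 : ET4 rlz;
  et4op : ET4op rlz }.

Section Notions.
Variable C : extriangulated_category.
Implicit Types (X U V W T : set C).

Definition conflation (A B D : C) (x : hom A B) (y : hom B D) : Prop :=
  exists d : ext (bif C) D A, realizes (rlz C) x y d.

Definition has_triangle (A B D : C) : Prop :=
  exists (x : hom A B) (y : hom B D), conflation x y.

Definition projective (P : C) : Prop :=
  forall (A B D : C) (x : hom A B) (y : hom B D), conflation x y ->
  forall f : hom P D, exists g : hom P B, y \oc g = f.

Definition injective_obj (I : C) : Prop :=
  forall (A B D : C) (x : hom A B) (y : hom B D), conflation x y ->
  forall f : hom A I, exists g : hom B I, g \oc x = f.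

Definition enough_projectives : Prop :=
  forall D : C, exists K P : C, projective P /\ has_triangle K P D.

Definition enough_injectives : Prop :=
  forall A : C, exists K I : C, injective_obj I /\ has_triangle A I K.

Definition syzygy (EP : enough_projectives) (D : C) : C := projT1 (cid (EP D)).

(* This is E^{i+1}(A, B); it starts at i = 0 with E(A, B). *)
Definition higher_ext (EP : enough_projectives) (i : nat) (A B : C) : zmodType :=
  ext (bif C) (iter i (syzygy EP) A) B.

Definition perp (EP : enough_projectives) X : set C :=
  [set B | forall A, X A -> forall (i : nat) (d : higher_ext EP i A B), d = 0].

Definition subcategory X : Prop :=
  [/\ forall Z : C, is_zero_obj Z -> X Z,
      forall (A B : C) (P : biproduct A B), X A -> X B -> X (bobj P),
      forall (A B : C) (f : hom A B), is_iso f -> X A -> X B &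
      forall (A B : C) (P : biproduct A B), X (bobj P) -> X A].

Definition ext_closed X : Prop :=
  forall A B D : C, has_triangle A B D -> X A -> X D -> X B.

Definition cocone_closed X : Prop :=
  forall A B D : C, has_triangle A B D -> X B -> X D -> X A.

Definition cone_closed X : Prop :=
  forall A B D : C, has_triangle A B D -> X A -> X B -> X D.

Definition resdim_le X (n : nat) : set C :=
  [set A | exists K S : nat -> C,
    [/\ K 0%N = A, K n = S n, forall i, (i <= n)%N -> X (S i) &
        forall i, (i < n)%N -> has_triangle (K i.+1) (S i) (K i)]].

Definition hat X : set C := \bigcup_n resdim_le X n.

Definition left_frobenius_pair (EP : enough_projectives) (XW : set C * set C) :
    Prop :=
  let: (X, W) := XW in
  [/\ subcategory X /\ subcategory W,
      ext_closed X /\ cocone_closed X,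
      W `<=` X,
      W `<=` perp EP X &
      forall A, X A -> exists B D, [/\ W B, X D & has_triangle A B D]].

Definition thick_subcategory T : Prop :=
  [/\ subcategory T, ext_closed T, cocone_closed T & cone_closed T].

Definition Thick X : set C := smallest thick_subcategory X.

Definition cotorsion_pair U V : Prop :=
  [/\ subcategory U /\ subcategory V,
      forall A B, U A -> V B -> forall d : ext (bif C) A B, d = 0,
      forall D, exists A B, [/\ V A, U B & has_triangle A B D] &
      forall D, exists A B, [/\ V A, U B & has_triangle D A B]].

End Notions.

(** * Extension-closed subcategories, with the restricted structure *)

Section Restriction.
Variables (C : extriangulated_category) (T : set C).
Hypotheses (subT : subcategory T) (extT : ext_closed T).

Definition sub_preadditive : preadditive_category :=
  @PreadditiveCategory {A : C | T A} (fun A B => hom (sval A) (sval B))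
    (fun A => idm (sval A)) (fun A B D g f => g \oc f)
    (fun _ _ _ _ => @mcompA C _ _ _ _) (fun _ _ => @comp1m C _ _)
    (fun _ _ => @compm1 C _ _) (fun _ _ _ => @compDl C _ _ _)
    (fun _ _ _ => @compDr C _ _ _).

Definition biproduct_of_sub (A B : sub_preadditive) (P : biproduct A B) :
    @biproduct C (sval A) (sval B) :=
  @Biproduct C (sval A) (sval B) (sval (bobj P)) (in1 P) (in2 P) (pr1 P) (pr2 P)
    (pr1in1 P) (pr2in2 P) (pr1in2 P) (pr2in1 P) (inprD P).

Lemma sub_zero_obj_ex : exists Z : sub_preadditive, is_zero_obj Z.
Proof.
case: (zero_obj_ex C) => Z Z0; case: subT => T0 _ _ _.
by exists (exist _ Z (T0 Z Z0)) => A; apply: Z0.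
Qed.

Lemma sub_biproduct_ex (A B : sub_preadditive) : inhabited (biproduct A B).
Proof.
case: (biproduct_ex (sval A) (sval B)) => P; case: subT => _ TD _ _.
have TP : T (bobj P) := TD _ _ P (svalP A) (svalP B).
exact: inhabits (@Biproduct sub_preadditive A B (exist _ (bobj P) TP)
  (in1 P) (in2 P) (pr1 P) (pr2 P)
  (pr1in1 P) (pr2in2 P) (pr1in2 P) (pr2in1 P) (inprD P)).
Qed.

Definition sub_additive : additive_category :=
  AdditiveCategory sub_zero_obj_ex sub_biproduct_ex.

Definition sub_bifunctor : additive_bifunctor sub_additive :=
  @AdditiveBifunctor sub_additive (fun X A => ext (bif C) (sval X) (sval A))
    (fun X A A' a => @push _ (bif C) (sval X) (sval A) (sval A') a)
    (fun X X' A c => @pull _ (bif C) (sval X) (sval X') (sval A) c)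
    (fun _ _ => @push1 _ (bif C) _ _) (fun _ _ => @pull1 _ (bif C) _ _)
    (fun _ _ _ _ => @push_comp _ (bif C) _ _ _ _)
    (fun _ _ _ _ => @pull_comp _ (bif C) _ _ _ _)
    (fun _ _ _ => @pushD _ (bif C) _ _ _)
    (fun _ _ _ => @pullD _ (bif C) _ _ _)
    (fun _ _ _ _ => @push_pull _ (bif C) _ _ _ _).

Definition sub_realizes (A B X : sub_additive) (x : hom A B) (y : hom B X)
    (d : ext sub_bifunctor X A) : Prop :=
  @realizes _ _ (rlz C) (sval A) (sval B) (sval X) x y d.

Lemma sub_rlz_ex (A X : sub_additive) (d : ext sub_bifunctor X A) :
  exists (B : sub_additive) (x : hom A B) (y : hom B X), sub_realizes x y d.
Proof.
have [B [x [y xyd]]] := rlz_ex (rlz C) d.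
have TB : T B.
  by apply: extT (svalP A) (svalP X); exists x, y, d.
by exists (exist _ B TB), x, y.
Qed.

Definition sub_realization : additive_realization sub_bifunctor :=
  @AdditiveRealization sub_additive sub_bifunctor sub_realizes sub_rlz_ex
    (fun _ _ _ _ => @rlzE _ _ (rlz C) _ _ _ _)
    (fun _ _ _ _ _ _ => @rlz_mor _ _ (rlz C) _ _ _ _ _ _)
    (fun _ _ P => rlz0 (rlz C) (biproduct_of_sub P))
    (fun _ _ _ _ _ _ _ _ _ _ _ _ PA PB PX =>
       @rlz_sum _ _ (rlz C) _ _ _ _ _ _ _ _ _ _ _ _
         (biproduct_of_sub PA) (biproduct_of_sub PB) (biproduct_of_sub PX)).

Lemma sub_ET3 : ET3 sub_realization.
Proof. by move=> A B X A' B' X'; apply: (et3 (e := C)). Qed.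

Lemma sub_ET3op : ET3op sub_realization.
Proof. by move=> A B X A' B' X'; apply: (et3op (e := C)). Qed.

Lemma sub_ET4 : ET4 sub_realization.
Proof.
move=> A B Y D F f f' d1 g g' d2 r1 r2.
have [Z [h' [d [e [d3 [c1 r3 r4 c2 c3]]]]]] := et4 r1 r2.
have TZ : T Z.
  by apply: extT (svalP D) (svalP F); exists d, e, (push (bif C) f' d2).
by exists (exist _ Z TZ), h', d, e, d3.
Qed.

Lemma sub_ET4op : ET4op sub_realization.
Proof.
move=> A B Y D F f f' d1 g g' d2 r1 r2.
have [Z [h' [d [e [d3 [c1 r3 r4 c2 c3]]]]]] := et4op r1 r2.
have TZ : T Z.
  by apply: extT (svalP F) (svalP D); exists e, d, (pull (bif C) f' d2).
by exists (exist _ Z TZ), h', d, e, d3.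
Qed.

Definition sub_extriangulated : extriangulated_category :=
  ExtriangulatedCategory sub_ET3 sub_ET3op sub_ET4 sub_ET4op.

End Restriction.

Section ThickCategory.
Variables (C : extriangulated_category) (X : set C).

Lemma Thick_subcategory : subcategory (Thick X).
Proof.
split.
- by move=> Z Z0 T [[[T0 _ _ _] _ _ _] _]; apply: T0.
- move=> A B P TA TB T TX; have [[[_ TD _ _] _ _ _] _] := TX.
  by apply: TD; [apply: TA | apply: TB].
- move=> A B f isof TA T TX; have [[[_ _ TI _] _ _ _] _] := TX.
  by apply: TI isof _; apply: TA.
- move=> A B P TP T TX; have [[[_ _ _ TS] _ _ _] _] := TX.
  by apply: (TS _ _ P); apply: TP.
Qed.

Lemma Thick_ext_closed : ext_closed (Thick X).
Proof.
move=> A B D ABD TA TD T TX; have [[_ TE _ _] _] := TX.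
by apply: TE ABD _ _; [apply: TA | apply: TD].
Qed.

Definition Thick_category : extriangulated_category :=
  sub_extriangulated Thick_subcategory Thick_ext_closed.

(* A class of objects of C, seen as a class of objects of Thick(X). *)
Definition in_Thick (Y : set C) : set Thick_category :=
  [set A : {A : C | Thick X A} | Y (sval A)].

End ThickCategory.

Arguments in_Thick {C} X Y.

Definition thick_cotorsion_pair (C : extriangulated_category)
    (EP : enough_projectives C) (UV : set C * set C) : Prop :=
  let: (U, V) := UV in
  [/\ U `<=` Thick U /\ V `<=` Thick U,
      cotorsion_pair (in_Thick U U) (in_Thick U V) &
      V `<=` perp EP U].

(* Main.v *)
Require Import Defs.
From mathcomp Require Import all_boot ssralg.
From mathcomp Require Import boolp classical_sets functions.

(** Almost all of the argument is carried out with the relation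
[has_triangle A B D], forgetting the morphisms.  (ET4) and its dual say that
inflations and deflations compose ([inflation_comp], [deflation_comp]); from
them one gets pullbacks and pushouts of triangles ([pullback_triangles],
[pushout_triangles]); and a triangle A -> B -> D with E(D, A) = 0 splits
([triangle_split]).

Let (X, W) be a left Frobenius pair and V the class of objects with a finite
W-resolution.  Dimension shifting gives E(X, V) = 0, even in all positive
degrees ([resolved_perp]).  The heart of the proof is that the class [approx]
of objects D admitting a triangle A -> B -> D with A in V and B in X (the
Auslander-Buchweitz approximation) is thick ([approx_thick]), so that it
contains Thick(X).  The cogenerator turns such a triangle into one
D -> A' -> B' with A' in V and B' in X ([approx_coresolution]), and these two
triangles are the ones required of the cotorsion pair (X, V).  Moreover V
consists of the D in [approx] with E(X, D) = 0 ([approx_perp_V]), which is why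
it is closed under direct summands.

Conversely, in a cotorsion pair (U, V) on Thick(U) the class U consists of the
objects D of Thick(U) with E(D, V) = 0 ([cotorsion_left_perp]).  So U is closed
under extensions, and it is closed under cocones of deflations because E^2(U, V)
vanishes as well ([cocone_ext_vanish]; the enough injectives are used here).
The approximation U -> V' -> U' of an object of U then has its middle term in
both U and V, which gives the cogenerator.

As for the composites: an object of X and V is a summand of an object of W,
since its cogenerator triangle splits ([XV_W]).  And V is determined by U
([cotorsion_right_sub]), so that (U, V) and the pair built from the left
Frobenius pair (U, U meet V) have the same second class. *)

Set Implicit Arguments.
Unset Strict Implicit.
Unset Printing Implicit Defensive.
Import GRing.Theory.
Local Open Scope classical_set_scope.

(** * Biproducts and isomorphisms *)

Section Preadditive.
Local Open Scope ring_scope.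
Variable C : preadditive_category.
Implicit Types A B D Z : C.

Lemma comp0m A B D (f : hom A B) : (0 : hom B D) \oc f = 0.
Proof. by apply: (addIr (0 \oc f)); rewrite -compDl !add0r. Qed.

Lemma compm0 A B D (g : hom B D) : g \oc (0 : hom A B) = 0.
Proof. by apply: (addIr (g \oc 0)); rewrite -compDr !add0r. Qed.

Lemma idm0_is_zero_obj Z : idm Z = 0 -> is_zero_obj Z.
Proof.
move=> Z0 A; split=> f; first by rewrite -(comp1m f) Z0 comp0m.
by rewrite -(compm1 f) Z0 compm0.
Qed.

Definition swap_biproduct A B (P : biproduct A B) : biproduct B A :=
  Biproduct (pr2in2 P) (pr1in1 P) (pr2in1 P) (pr1in2 P)
    (etrans (addrC _ _) (inprD P)).

Lemma biproduct_iso A D (P : biproduct A D) B (b : hom (bobj P) B) :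
  is_iso b -> exists Q : biproduct A D, bobj Q = B.
Proof.
case=> c [cb bc].
have cancel Y Y' (p : hom (bobj P) Y') (i : hom Y (bobj P)) :
    (p \oc c) \oc (b \oc i) = p \oc i.
  by rewrite mcompA -(mcompA p c b) cb compm1.
unshelve eexists (@Biproduct _ A D B (b \oc in1 P) (b \oc in2 P)
  (pr1 P \oc c) (pr2 P \oc c) _ _ _ _ _) => //; rewrite ?cancel.
- exact: pr1in1.
- exact: pr2in2.
- exact: pr1in2.
- exact: pr2in1.
rewrite !mcompA -compDl -(mcompA b (in1 P)) -(mcompA b (in2 P)) -compDr inprD.
by rewrite compm1.
Qed.

(** Presenting any object isomorphic to A as a biproduct of A and a zero object
reduces invariance under isomorphism to additivity. *)
Lemma biproduct_iso_zero A B Z (f : hom A B) :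
  is_iso f -> is_zero_obj Z -> exists P : biproduct A Z, bobj P = B.
Proof.
case=> g [gf fg] Z0.
unshelve eexists (@Biproduct _ A Z B f 0 g 0 gf _ _ _ _) => //.
- by rewrite compm0 (proj1 (Z0 Z) (idm Z)).
- exact: compm0.
- exact: comp0m.
- by rewrite comp0m fg addr0.
Qed.

Lemma is_iso_inv A B (f : hom A B) :
  is_iso f -> exists g : hom B A, is_iso g.
Proof. by case=> g [gf fg]; exists g, f. Qed.

Lemma is_iso_idm A : is_iso (idm A).
Proof. by exists (idm A); rewrite comp1m. Qed.

Lemma biproduct_zero A Z :
  is_zero_obj Z -> exists P : biproduct A Z, bobj P = A.
Proof. exact: biproduct_iso_zero (is_iso_idm A). Qed.

End Preadditive.

(** * Existence of triangles and vanishing of extensions *)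

Section Triangles.
Local Open Scope ring_scope.
Variable C : extriangulated_category.
Implicit Types A B D Z : C.
Local Notation E := (bif C).

Lemma push0m X A A' (d : ext E X A) : push E (0 : hom A A') d = 0.
Proof. by apply: (addIr (push E 0 d)); rewrite -pushD !add0r. Qed.

Lemma pull0m X X' A (d : ext E X A) : pull E (0 : hom X' X) d = 0.
Proof. by apply: (addIr (pull E 0 d)); rewrite -pullD !add0r. Qed.

Lemma biproduct_triangle A B (P : biproduct A B) : has_triangle A (bobj P) B.
Proof. by exists (in1 P), (pr2 P), 0; apply: rlz0. Qed.

Lemma biproduct_triangle_swap A B (P : biproduct A B) :
  has_triangle B (bobj P) A.
Proof. exact: (biproduct_triangle (swap_biproduct P)). Qed.

Lemma zero_triangle Z A : is_zero_obj Z -> has_triangle Z A A.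
Proof.
move=> /(biproduct_zero A)[P PA].
by have := biproduct_triangle_swap P; rewrite PA.
Qed.

Lemma triangle_sum A B D A' B' D' (PA : biproduct A A') (PB : biproduct B B')
    (PD : biproduct D D') :
  has_triangle A B D -> has_triangle A' B' D' ->
  has_triangle (bobj PA) (bobj PB) (bobj PD).
Proof.
move=> [x [y [d r]]] [x' [y' [d' r']]].
exists (msum PA PB x x'), (msum PB PD y y'), (ext_sum PA PD d d').
exact: rlz_sum.
Qed.

(** Adding the triangle 0 -> 0 -> 0 replaces the end terms by isomorphic
objects, because additivity of the realization holds for any choice of the
biproducts. *)
Lemma triangle_iso A B D A' D' (f : hom A A') (g : hom D D') :
  is_iso f -> is_iso g -> has_triangle A B D -> has_triangle A' B D'.
Proof.
move=> isof isog t; have [Z Z0] := zero_obj_ex C.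
have [PA <-] := biproduct_iso_zero isof Z0.
have [PD <-] := biproduct_iso_zero isog Z0.
have [PB eB] := biproduct_iso_zero (is_iso_idm B) Z0.
rewrite -[in has_triangle _ B _]eB.
exact: triangle_sum t (zero_triangle _ Z0).
Qed.

Lemma inflation_comp A B Y D F :
  has_triangle A B D -> has_triangle B Y F ->
  exists2 Z : C, has_triangle A Y Z & has_triangle D Z F.
Proof.
move=> [f [f' [d1 r1]]] [g [g' [d2 r2]]].
have [Z [h' [d [e [d3 [_ r3 r4 _ _]]]]]] := et4 r1 r2.
by exists Z; [exists (g \oc f), h', d3 | exists d, e, (push E f' d2)].
Qed.

Lemma deflation_comp A B Y D F :
  has_triangle D B A -> has_triangle F Y B ->
  exists2 Z : C, has_triangle Z Y A & has_triangle F Z D.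
Proof.
move=> [f' [f [d1 r1]]] [g' [g [d2 r2]]].
have [Z [h' [d [e [d3 [_ r3 r4 _ _]]]]]] := et4op r1 r2.
by exists Z; [exists h', (f \oc g), d3 | exists e, d, (pull E f' d2)].
Qed.

(** (ET4) applied to the split inflation A2 -> A1 (+) A2 followed by j; its
other triangle realizes pr1_* mu, which identifies the cone of A2 -> M. *)
Lemma pushout_split_triangle A1 A2 B1 D M (P : biproduct A1 A2)
    (j : hom (bobj P) M) (k : hom M D) (mu : ext E D (bobj P))
    (x : hom A1 B1) (y : hom B1 D) :
  realizes (rlz C) j k mu -> realizes (rlz C) x y (push E (pr1 P) mu) ->
  has_triangle A2 M B1.
Proof.
move=> rmu r1; have r2 := rlz0 (rlz C) (swap_biproduct P).
have [Z [h' [d [e [d3 [_ r3 r4 _ _]]]]]] := et4 r2 rmu.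
have [b [isob _ _]] := (rlzE _ _ r4).1 r1.
apply: (triangle_iso (is_iso_idm A2) isob).
by exists (j \oc in2 P), h', d3.
Qed.

(** Dual of [pushout_split_triangle], through (ET4)op. *)
Lemma pullback_split_triangle A D1 D2 B1 M (P : biproduct D1 D2)
    (j : hom A M) (k : hom M (bobj P)) (mu : ext E (bobj P) A)
    (x : hom A B1) (y : hom B1 D1) :
  realizes (rlz C) j k mu -> realizes (rlz C) x y (pull E (in1 P) mu) ->
  has_triangle B1 M D2.
Proof.
move=> rmu r1; have r2 := rlz0 (rlz C) P.
have [Z [h' [d [e [d3 [_ r3 r4 _ _]]]]]] := et4op r2 rmu.
have [b [isob _ _]] := (rlzE _ _ r4).1 r1.
apply: (triangle_iso isob (is_iso_idm D2)).
by exists h', (pr2 P \oc k), d3.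
Qed.

(** The pullback M of B1 -> D <- B2 is realized by the extension of D by
A1 (+) A2 with components d1 and d2. *)
Lemma pullback_triangles A1 B1 A2 B2 D :
  has_triangle A1 B1 D -> has_triangle A2 B2 D ->
  exists2 M : C, has_triangle A2 M B1 & has_triangle A1 M B2.
Proof.
move=> [x1 [y1 [d1 r1]]] [x2 [y2 [d2 r2]]].
have [P] := biproduct_ex A1 A2.
pose mu := push E (in1 P) d1 + push E (in2 P) d2.
have [M [j [k r]]] := rlz_ex (rlz C) mu.
exists M.
  apply: (pushout_split_triangle (x := x1) (y := y1) r).
  by rewrite raddfD /= -!push_comp pr1in1 pr1in2 push1 push0m addr0.
apply: (pushout_split_triangle (P := swap_biproduct P) (x := x2) (y := y2) r).
by rewrite raddfD /= -!push_comp pr2in1 pr2in2 push1 push0m add0r.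
Qed.

Lemma pushout_triangles A B1 D1 B2 D2 :
  has_triangle A B1 D1 -> has_triangle A B2 D2 ->
  exists2 M : C, has_triangle B1 M D2 & has_triangle B2 M D1.
Proof.
move=> [x1 [y1 [d1 r1]]] [x2 [y2 [d2 r2]]].
have [P] := biproduct_ex D1 D2.
pose mu := pull E (pr1 P) d1 + pull E (pr2 P) d2.
have [M [j [k r]]] := rlz_ex (rlz C) mu.
exists M.
  apply: (pullback_split_triangle (x := x1) (y := y1) r).
  by rewrite raddfD /= -!pull_comp pr1in1 pr2in1 pull1 pull0m addr0.
apply: (pullback_split_triangle (P := swap_biproduct P) (x := x2) (y := y2) r).
by rewrite raddfD /= -!pull_comp pr1in2 pr2in2 pull1 pull0m add0r.
Qed.

Definition ext_vanish A B : Prop := forall d : ext E A B, d = 0.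

Lemma triangle_split A B D :
  has_triangle A B D -> ext_vanish D A -> exists P : biproduct A D, bobj P = B.
Proof.
move=> [x [y [d r]]] D0; have [P] := biproduct_ex A D.
move: r; rewrite (D0 d) => r.
have [b [isob _ _]] := (rlzE _ _ (rlz0 (rlz C) P)).1 r.
exact: biproduct_iso isob.
Qed.

Lemma triangle_swap A B D :
  has_triangle A B D -> ext_vanish D A -> has_triangle D B A.
Proof.
by move=> t D0; have [P <-] := triangle_split t D0; apply: biproduct_triangle_swap.
Qed.

Lemma ext_vanish_summand A A' B (P : biproduct A A') :
  ext_vanish B (bobj P) -> ext_vanish B A.
Proof.
move=> P0 d; rewrite -(push1 d) -(pr1in1 P) push_comp.
by rewrite (P0 (push _ _ d)) raddf0.
Qed.

(** Exactness of Hom(O, B) -> Hom(O, D) -> E(O, A): the obstruction to lifting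
lies in E(O, A), and a lift is read off on a split triangle
A -> A (+) O -> O. *)
Lemma lift_deflation A B D (x : hom A B) (y : hom B D) (O : C) (c : hom O D) :
  conflation x y -> ext_vanish O A -> exists c' : hom O B, y \oc c' = c.
Proof.
move=> [d r] O0; have [P] := biproduct_ex A O.
have := rlz_mor (rlz0 (rlz C) P) r (a := idm A) (c := c).
rewrite raddf0 (O0 (pull E c d)) => /(_ erefl)[b [_ eb]].
by exists (b \oc in2 P); rewrite mcompA eb -mcompA pr2in2 compm1.
Qed.

Lemma extend_inflation A B D (x : hom A B) (y : hom B D) (S : C) (c : hom A S) :
  conflation x y -> ext_vanish D S -> exists c' : hom B S, c' \oc x = c.
Proof.
move=> [d r] D0; have [P] := biproduct_ex S D.
have := rlz_mor r (rlz0 (rlz C) P) (a := c) (c := idm D).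
rewrite raddf0 (D0 (push E c d)) => /(_ erefl)[b [eb _]].
by exists (pr1 P \oc b); rewrite -mcompA eb mcompA pr1in1 comp1m.
Qed.

(** An extension by an injective object has a retraction of its inflation, hence
a morphism to the split triangle that is the identity on I. *)
Lemma injective_ext_vanish I D : injective_obj I -> ext_vanish D I.
Proof.
move=> injI d; have [B [x [y r]]] := rlz_ex (rlz C) d.
have [g gx] := injI _ _ _ _ _ (ex_intro _ d r) (idm I).
have [P] := biproduct_ex I D.
have eb : (in1 P \oc g) \oc x = in1 P \oc idm I by rewrite -mcompA gx.
have [c [_]] := et3 r (rlz0 (rlz C) P) eb.
by rewrite push1 raddf0.
Qed.

(** Exactness of E(Z, A) -> E(Z, B) -> E(Z, D): for d in E(Z, B), (ET4) gives a
triangle D -> W -> Z realizing y_* d; it splits, and a section s of it yields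
d = x_* (s^* d3). *)
Lemma ext_vanish_ext_middle Z A B D :
  has_triangle A B D -> ext_vanish Z A -> ext_vanish Z D -> ext_vanish Z B.
Proof.
move=> [x [y [d1 r1]]] A0 D0 d; have [G [g [g' r2]]] := rlz_ex (rlz C) d.
have [W [h' [u [e [d3 [_ _ r4 _ e4]]]]]] := et4 r1 r2.
have [s es] : exists s : hom Z W, e \oc s = idm Z.
  by apply: (lift_deflation (A := D) (x := u)) D0; exists (push E y d).
by rewrite -(pull1 d) -es pull_comp -e4 -push_pull (A0 (pull E s d3)) raddf0.
Qed.

(** Dual of [ext_vanish_ext_middle]. *)
Lemma ext_middle_vanish Z A B D :
  has_triangle A B D -> ext_vanish A Z -> ext_vanish D Z -> ext_vanish B Z.
Proof.
move=> [x [y [d1 r1]]] A0 D0 d; have [G [g' [g r2]]] := rlz_ex (rlz C) d.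
have [W [h' [u [e [d3 [_ _ r4 _ e4]]]]]] := et4op r1 r2.
have [s es] : exists s : hom W Z, s \oc e = idm Z.
  by apply: (extend_inflation (D := A) (y := u)) A0; exists (pull E x d).
by rewrite -(push1 d) -es push_comp -e4 push_pull (D0 (push E s d3)) raddf0.
Qed.

(** Exactness of E(Z, S) -> E(Z, D) -> E^2(Z, K), with E^2(Z, K) = E(O, K) for O
a syzygy of Z: every element of E(Z, D) is the pushforward of the syzygy
extension along some O -> D, which lifts to S. *)
Lemma ext_vanish_cone Z O P K S D :
  projective P -> has_triangle O P Z -> has_triangle K S D ->
  ext_vanish O K -> ext_vanish Z S -> ext_vanish Z D.
Proof.
move=> projP [o [p [eps re]]] [x [y cxy]] O0 Z0 d.
have [G [u [v r]]] := rlz_ex (rlz C) d.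
have [b vb] := projP _ _ _ _ _ (ex_intro _ d r) p.
have eb : idm Z \oc p = v \oc b by rewrite comp1m.
have [a [_]] := et3op re r eb.
rewrite pull1 => <-.
have [a' <-] := lift_deflation a cxy O0.
by rewrite push_comp (Z0 (push E a' eps)) raddf0.
Qed.

(** Exactness of E(B, Z) -> E(A, Z) -> E^2(D, Z).  The group E^2(D, Z) is given
by a syzygy O of D, but the argument needs it as E(D, S) with S a cosyzygy of
Z; [ext_vanish_cone] for the triangle Z -> I -> S converts the one vanishing
into the other. *)
Lemma cocone_ext_vanish Z A B D O P :
  enough_injectives C -> projective P -> has_triangle O P D ->
  has_triangle A B D -> ext_vanish O Z -> ext_vanish B Z -> ext_vanish A Z.
Proof.
move=> EI projP tO [x [y cxy]] O0 B0 d.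
have [S [I [injI tI]]] := EI Z.
have DS : ext_vanish D S.
  exact: ext_vanish_cone projP tO tI O0 (injective_ext_vanish injI).
have [i [q [eps re]]] := tI.
have [G [u [v r]]] := rlz_ex (rlz C) d.
have [b bu] := injI _ _ _ _ _ (ex_intro _ d r) i.
have eb : b \oc u = i \oc idm Z by rewrite compm1.
have [c [_]] := et3 r re eb.
rewrite push1 => ->.
have [c' <-] := extend_inflation c cxy DS.
by rewrite pull_comp (B0 (pull E c' eps)) raddf0.
Qed.

End Triangles.

(** * Resolutions, subcategories and thick closures *)

Section Resolutions.
Variable C : extriangulated_category.
Implicit Types (X T : set C).

(** [hat] as an inductive predicate, so that proofs go by induction on the
resolution ([hatE]). *)
Inductive resolved X : C -> Prop :=
| resolved0 A : X A -> resolved X A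
| resolvedS K S A : has_triangle K S A -> X S -> resolved X K -> resolved X A.

Lemma hatE X : hat X = resolved X.
Proof.
apply/seteqP; split=> A.
  move=> [n _ [K [S [<- Kn XS t]]]].
  (* The tail of the resolution starting at K (n - m) has length m. *)
  suff H m : (m <= n)%N -> resolved X (K (n - m)%N).
    by have := H n (leqnn n); rewrite subnn.
  elim: m => [|m IHm] lmn.
    by rewrite subn0 Kn; apply: resolved0; apply: XS.
  have lt : (n - m.+1 < n)%N by rewrite ltn_subrL (leq_trans _ lmn).
  apply: (resolvedS (t _ lt)); first exact: XS (ltnW lt).
  by rewrite -subSn // subSS; apply: IHm; apply: ltnW.
elim=> {A} [A XA | K S A t XS _ [n _ [K' [S' [K0 Kn XS' t']]]]].
  by exists 0%N => //; exists (fun=> A), (fun=> A); split.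
exists n.+1 => //.
exists (fun i => if i is j.+1 then K' j else A).
exists (fun i => if i is j.+1 then S' j else S).
split=> //; first by case.
by case=> [|i] /= lin; [rewrite K0 | apply: t'].
Qed.

(** An object isomorphic to A is a summand of A, with a zero complement. *)
Lemma subcategory_intro X :
  (forall Z, is_zero_obj Z -> X Z) -> ext_closed X ->
  (forall (A B : C) (P : biproduct A B), X (bobj P) -> X A) -> subcategory X.
Proof.
move=> X0 Xe Xs; split=> //.
  by move=> A B P XA XB; apply: Xe XA XB; apply: biproduct_triangle.
move=> A B f /is_iso_inv[g isog] XA.
have [Z Z0] := zero_obj_ex C.
have [P PA] := biproduct_iso_zero isog Z0.
by apply: (Xs _ _ P); rewrite PA.
Qed.

Lemma subcategory_split X A B D :
  subcategory X -> X B -> has_triangle A B D -> ext_vanish D A -> X A.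
Proof.
move=> [_ _ _ Xs] XB t D0; have [P PB] := triangle_split t D0.
by apply: (Xs _ _ P); rewrite PB.
Qed.

Lemma subcategory_splitr X A B D :
  subcategory X -> X B -> has_triangle A B D -> ext_vanish D A -> X D.
Proof.
move=> [_ _ _ Xs] XB t D0; have [P PB] := triangle_split t D0.
by apply: (Xs _ _ (swap_biproduct P)); rewrite PB.
Qed.

Lemma sub_Thick X : X `<=` Thick X.
Proof. by move=> A XA T [_]; apply. Qed.

Lemma Thick_cone_closed X : cone_closed (Thick X).
Proof.
move=> A B D t TA TB T TX; have [[_ _ _ Tc] _] := TX.
by apply: Tc t _ _; [apply: TA | apply: TB].
Qed.

Lemma Thick_cocone_closed X : cocone_closed (Thick X).
Proof.
move=> A B D t TB TD T TX; have [[_ _ Tc _] _] := TX.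
by apply: Tc t _ _; [apply: TB | apply: TD].
Qed.

Lemma resolved_Thick X Y : Y `<=` Thick X -> resolved Y `<=` Thick X.
Proof.
move=> sY A; elim=> [B /sY // | K S B t /sY TS _ TK].
exact: Thick_cone_closed t TK TS.
Qed.

End Resolutions.

(** * Right orthogonals *)

Section Perp.
Variables (C : extriangulated_category) (EP : enough_projectives C).
Implicit Types (A B D K S : C) (Y : set C).

Lemma syzygy_triangle D :
  exists2 P : C, projective P & has_triangle (syzygy EP D) P D.
Proof. by rewrite /syzygy; case: cid => K [P [projP t]]; exists P. Qed.

Lemma perp_cone Y K S D :
  has_triangle K S D -> perp EP Y K -> perp EP Y S -> perp EP Y D.
Proof.
move=> t YK YS A YA i; have [P projP tP] := syzygy_triangle (iter i (syzygy EP) A).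
exact: ext_vanish_cone projP tP t (YK A YA i.+1) (YS A YA i).
Qed.

Lemma perp_ext_vanish Y A B :
  perp EP Y B -> Y A -> ext_vanish A B.
Proof. by move=> pB YA; apply: (pB A YA 0%N). Qed.

End Perp.

(** * The cotorsion pair attached to a left Frobenius pair *)

Section FrobeniusPair.
Variables (C : extriangulated_category) (EP : enough_projectives C).
Variables X W : set C.
Hypothesis frob : left_frobenius_pair EP (X, W).
Local Notation V := (resolved W).

Let subX : subcategory X. Proof. by case: frob => -[]. Qed.
Let subW : subcategory W. Proof. by case: frob => -[]. Qed.
Let extX : ext_closed X. Proof. by case: frob => _ []. Qed.
Let cocX : cocone_closed X. Proof. by case: frob => _ []. Qed.
Let sWX : W `<=` X. Proof. by case: frob. Qed.
Let cogen A : X A -> exists B D, [/\ W B, X D & has_triangle A B D].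
Proof. by case: frob => _ _ _ _; apply. Qed.

Lemma resolved_perp : V `<=` perp EP X.
Proof.
have sWp : W `<=` perp EP X by case: frob.
by move=> A; elim=> [B /sWp // | K S B t /sWp pS _ pK]; apply: perp_cone t pK pS.
Qed.

Lemma XV_vanish A B : X A -> V B -> ext_vanish A B.
Proof. by move=> XA /resolved_perp pB; apply: perp_ext_vanish pB XA. Qed.

Lemma W_ext_closed : ext_closed W.
Proof.
move=> A B D t WA WD; have [_ Wb _ _] := subW.
have [P <-] := triangle_split t (XV_vanish (sWX WD) (resolved0 WA)).
exact: Wb.
Qed.

(** Since the triangle splits, K and D may change places; pulling the first step
of the resolution of K back along L -> K then resolves L. *)
Lemma extension_W_resolved K L D : has_triangle K L D -> V K -> W D -> V L.
Proof.
move=> t VK WD; have t' := triangle_swap t (XV_vanish (sWX WD) VK).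
case: VK t' {t} => [{}K WK t' | K' S {}K tK WS VK' t'].
  exact/resolved0/(W_ext_closed t').
have [N tN1 tN2] := pullback_triangles tK t'.
by apply: (resolvedS tN2 _ VK'); apply: W_ext_closed tN1 WD WS.
Qed.

(** A horseshoe argument.  Let M -> S -> D be the first step of the resolution
of D.  The pullback H of L and S is resolved by [extension_W_resolved], and L is
the cone of M -> H.  If K' -> W' -> H is the first step for H, the cocone N of
W' -> L is an extension of M by K', hence resolved by induction. *)
Lemma resolved_ext_closed : ext_closed V.
Proof.
move=> K L D t VK VD; elim: VD K L t VK => {D} [D WD|M S D tD WS VM IH] K L t VK.
  exact: extension_W_resolved t VK WD.
have [H tMH tKH] := pullback_triangles t tD.
have VH := extension_W_resolved tKH VK WS.
case: VH tMH {tKH} => [{}H WH|K' W' {}H tH WW' VK'] tMH.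
  exact: resolvedS tMH WH VM.
have [N tNW tKN] := deflation_comp tMH tH.
exact: resolvedS tNW WW' (IH _ _ tKN VK').
Qed.

(** The objects with a right X-approximation whose kernel lies in V; this is
also the class of objects of finite X-resolution dimension. *)
Definition approx : set C :=
  [set D | exists A B, [/\ V A, X B & has_triangle A B D]].

Lemma X_approx : X `<=` approx.
Proof.
move=> D XD; have [Z Z0] := zero_obj_ex C; have [W0 _ _ _] := subW.
by exists Z, D; split=> //; [apply/resolved0/W0 | apply: zero_triangle].
Qed.

Lemma V_approx : V `<=` approx.
Proof.
move=> D; case=> [B /sWX/X_approx // | K S B t WS VK].
by exists K, S; split=> //; apply: sWX.
Qed.

(** Embed B into W0 with cone in X; then A -> W0 is an inflation whose cone is
still W-resolved and receives D. *)
Lemma approx_coresolution D :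
  approx D -> exists A B, [/\ V A, X B & has_triangle D A B].
Proof.
move=> [A [B [VA XB t]]]; have [W0 [X0 [WW0 XX0 t0]]] := cogen XB.
have [Z tAZ tDZ] := inflation_comp t t0.
by exists Z, X0; split=> //; apply: resolvedS tAZ WW0 VA.
Qed.

Lemma approx_cocone_X D G B : has_triangle D G B -> approx G -> X B -> approx D.
Proof.
move=> t [A [M [VA XM tG]]] XB; have [Z tZM tAZ] := deflation_comp t tG.
by exists A, Z; split=> //; apply: cocX tZM XM XB.
Qed.

Lemma approx_cone_V A H G : has_triangle A H G -> V A -> approx H -> approx G.
Proof.
move=> t VA [K [N [VK XN tH]]]; have [Z tZN tKZ] := deflation_comp t tH.
by exists Z, N; split=> //; apply: resolved_ext_closed tKZ VK VA.
Qed.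

(** The pulled-back cover N is an extension of S by B, so it stays in X. *)
Lemma extension_pullback B H A K S :
  has_triangle B H A -> X B -> has_triangle K S A -> X S ->
  exists2 N, X N & has_triangle K N H.
Proof.
move=> tH XB tA XS; have [N tBN tKN] := pullback_triangles tA tH.
by exists N => //; apply: extX tBN XB XS.
Qed.

Lemma approx_extension_XV B H A : has_triangle B H A -> X B -> V A -> approx H.
Proof.
move=> t XB VA; case: VA t => [{}A WA|K S {}A tA WS VK] t.
  exact/X_approx/(extX t XB (sWX WA)).
have [N XN tN] := extension_pullback t XB tA (sWX WS).
by exists K, N.
Qed.

(** Pushing D out along D1 -> A1 reduces to an extension G of D2 by A1 in V,
since D is the cocone of a deflation from G to X1.  Pulling G back to the
approximation B2 of D2 gives a split extension H of B2 by A1, and G is a cone of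
A2 -> H. *)
Lemma approx_ext_closed : ext_closed approx.
Proof.
move=> D1 D D2 t aD1 [A2 [B2 [VA2 XB2 tD2]]].
have [A1 [X1 [VA1 XX1 tD1]]] := approx_coresolution aD1.
have [G tDG tAG] := pushout_triangles t tD1.
apply: (approx_cocone_X tDG _ XX1).
have [H tA2H tA1H] := pullback_triangles tAG tD2.
apply: (approx_cone_V tA2H VA2).
exact: approx_extension_XV (triangle_swap tA1H (XV_vanish XB2 VA1)) XB2 VA1.
Qed.

Lemma approx_cone_closed : cone_closed approx.
Proof.
move=> D1 D2 D3 t aD1 aD2.
have [A1 [X1 [VA1 XX1 tD1]]] := approx_coresolution aD1.
have [G tDG tAG] := pushout_triangles t tD1.
apply: (approx_cone_V tAG VA1).
exact: approx_ext_closed tDG aD2 (X_approx XX1).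
Qed.

Lemma approx_cocone_closed : cocone_closed approx.
Proof.
move=> D1 D2 D3 t aD2 [A3 [B3 [VA3 XB3 tD3]]].
have [M tAM tDM] := pullback_triangles t tD3.
apply: (approx_cocone_X tDM _ XB3).
exact: approx_ext_closed tAM (V_approx VA3) aD2.
Qed.

(** Let L and L' be the cocones of the composites of B -> D (+) D' with the two
projections.  The pullback H of B and R = B (+) B over D (+) D' is at the same
time an extension of R by A and of B by L (+) L', so information on A passes to
L (+) L'. *)
Lemma summand_cover A B D D' (P : biproduct D D') :
  X B -> has_triangle A B (bobj P) ->
  exists (L L' : C) (Q : biproduct L L') (R H : C),
    [/\ X R, has_triangle A H R, has_triangle (bobj Q) H B,
        approx L -> approx D & approx L' -> approx D'].
Proof.
move=> XB t.
have [L tL _] := deflation_comp (biproduct_triangle_swap P) t.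
have [L' tL' _] := deflation_comp (biproduct_triangle P) t.
have [Q] := biproduct_ex L L'; have [R] := biproduct_ex B B.
have [H tQH tAH] := pullback_triangles t (triangle_sum Q R P tL tL').
exists L, L', Q, (bobj R), H; split=> //.
- by case: subX => _ Xb _ _; apply: Xb.
- by move=> aL; apply: approx_cone_closed tL aL (X_approx XB).
- by move=> aL'; apply: approx_cone_closed tL' aL' (X_approx XB).
Qed.

(** By induction on the resolution of A, in the notation of [summand_cover]: the
extension H of R by A splits, so it has an X-cover with kernel K one step
further in the resolution of A, and so has L (+) L'.  When A lies in W, the
objects H and L (+) L' lie in X itself. *)
Lemma approx_summand D D' (P : biproduct D D') : approx (bobj P) -> approx D.
Proof.
move=> [A [B [VA XB t]]].
suff: approx D /\ approx D' by case.
elim: VA B D D' P XB t => {A} [A WA | K S A tA WS VK IH] B D D' P XB t;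
  have [L [L' [Q [R [H [XR tAH tQH aD aD']]]]]] := summand_cover XB t.
- have XH : X H := extX tAH (sWX WA) XR.
  have XQ : X (bobj Q) := cocX tQH XH XB.
  have [_ _ _ Xs] := subX.
  split; [apply/aD/X_approx/(Xs _ _ Q) | apply/aD'/X_approx] => //.
  exact: Xs (swap_biproduct Q) XQ.
have tRH := triangle_swap tAH (XV_vanish XR (resolvedS tA WS VK)).
have [N XN tN] := extension_pullback tRH XR tA (sWX WS).
have [Z tZN tKZ] := deflation_comp tQH tN.
by have [/aD ? /aD'] := IH _ _ _ Q (cocX tZN XN XB) tKZ.
Qed.

Lemma approx_thick : thick_subcategory approx.
Proof.
split; [|exact: approx_ext_closed|exact: approx_cocone_closed|
        exact: approx_cone_closed].
apply: subcategory_intro; [|exact: approx_ext_closed|exact: approx_summand].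
by move=> Z Z0; apply: X_approx; case: subX => X0 _ _ _; apply: X0.
Qed.

Lemma Thick_approx : Thick X `<=` approx.
Proof. by move=> A; apply; split; [exact: approx_thick | exact: X_approx]. Qed.

Lemma V_Thick : V `<=` Thick X.
Proof. by apply: resolved_Thick => A /sWX; apply: sub_Thick. Qed.

Lemma XV_W A : X A -> V A -> W A.
Proof.
move=> XA VA; have [B [D [WB XD t]]] := cogen XA.
exact: subcategory_split subW WB t (XV_vanish XD VA).
Qed.

(** In A -> B -> D, the vanishing of E(X, A) and E(X, D) gives that of E(X, B);
so the cogenerator triangle of B splits and B lies in W. *)
Lemma approx_perp_V D :
  approx D -> (forall A, X A -> ext_vanish A D) -> V D.
Proof.
move=> [A [B [VA XB t]]] D0; apply: resolvedS (t) _ (VA).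
have [S [Y [WS XY tB]]] := cogen XB; apply: subcategory_split subW WS tB _.
exact: ext_vanish_ext_middle t (XV_vanish XY VA) (D0 _ XY).
Qed.

Lemma resolved_subcategory : subcategory V.
Proof.
apply: subcategory_intro; [|exact: resolved_ext_closed|].
  by move=> Z Z0; apply: resolved0; case: subW => W0 _ _ _; apply: W0.
move=> A B P VP; apply: approx_perp_V.
  exact: approx_summand (V_approx VP).
by move=> D XD; apply: ext_vanish_summand (XV_vanish XD VP).
Qed.

End FrobeniusPair.

(** * Subcategories seen inside the thick closure *)

Section ThickRestriction.
Variables (C : extriangulated_category) (X : set C).

(** Zero objects, biproducts and isomorphisms of the full subcategory Thick(X)
are also such in C. *)
Lemma subcategory_in_Thick (Y : set C) :
  subcategory Y -> subcategory (in_Thick X Y).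
Proof.
move=> [Y0 Yb Yi Ys]; split.
- move=> Z Z0; apply: Y0; apply: idm0_is_zero_obj.
  exact: (proj1 (Z0 Z) (idm Z)).
- by move=> A B P; apply: (Yb _ _ (biproduct_of_sub P)).
- by move=> A B f; apply: (Yi _ _ f).
- by move=> A B P; apply: (Ys _ _ (biproduct_of_sub P)).
Qed.

Lemma subcategory_of_in_Thick (Y : set C) :
  Y `<=` Thick X -> subcategory (in_Thick X Y) -> subcategory Y.
Proof.
move=> sY [Y0 Yb Yi Ys]; have [T0 Tb Ti Ts] := @Thick_subcategory C X.
pose mk (A : C) (TA : Thick X A) : Thick_category X := exist _ A TA.
have mkP A B (TA : Thick X A) (TB : Thick X B) (P : biproduct A B)
    (TP : Thick X (bobj P)) :
    {Q : @biproduct (Thick_category X) (mk A TA) (mk B TB) | bobj Q = mk _ TP}.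
  by exists (@Biproduct (Thick_category X) (mk A TA) (mk B TB) (mk _ TP)
    (in1 P) (in2 P) (pr1 P) (pr2 P)
    (pr1in1 P) (pr2in2 P) (pr1in2 P) (pr2in1 P) (inprD P)).
split.
- by move=> Z Z0; apply: (Y0 (mk Z (T0 Z Z0))) => A; apply: Z0.
- move=> A B P YA YB; have TP := Tb _ _ P (sY _ YA) (sY _ YB).
  have [Q QP] := mkP _ _ (sY _ YA) (sY _ YB) P TP.
  by have := Yb _ _ Q YA YB; rewrite QP.
- move=> A B f isof YA; have TB := Ti _ _ f isof (sY _ YA).
  exact: (Yi (mk A (sY _ YA)) (mk B TB) f isof YA).
- move=> A B P YP; have TA := Ts _ _ P (sY _ YP).
  have TB := Ts _ _ (swap_biproduct P) (sY _ YP).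
  have [Q QP] := mkP _ _ TA TB P (sY _ YP).
  by apply: (Ys _ _ Q); rewrite QP.
Qed.

End ThickRestriction.

(** * The two assignments *)

Section Correspondence.
Variables (C : extriangulated_category) (EP : enough_projectives C).
Implicit Types U V X W : set C.

Lemma frobenius_cotorsion X W :
  left_frobenius_pair EP (X, W) -> thick_cotorsion_pair EP (X, hat W).
Proof.
move=> frob; rewrite hatE.
have VT := V_Thick frob.
have XT : X `<=` Thick X by apply: sub_Thick.
split; [by split | | exact: resolved_perp frob].
split.
- split; apply: subcategory_in_Thick; last exact: resolved_subcategory frob.
  by case: frob => -[].
- by move=> A B XA VB; apply: XV_vanish frob _ _ XA VB.
- move=> [D TD]; have [A [B [VA XB t]]] := Thick_approx frob TD.
  by exists (exist _ A (VT _ VA)), (exist _ B (XT _ XB)).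
- move=> [D TD].
  have [A [B [VA XB t]]] := approx_coresolution frob (Thick_approx frob TD).
  by exists (exist _ A (VT _ VA)), (exist _ B (XT _ XB)).
Qed.

Lemma cotorsion_vanish U V A B :
  thick_cotorsion_pair EP (U, V) -> U A -> V B -> ext_vanish A B.
Proof. by move=> [_ _ sV] UA /sV pB; apply: perp_ext_vanish pB UA. Qed.

Lemma cotorsion_approx U V D :
  thick_cotorsion_pair EP (U, V) -> Thick U D ->
  (exists A B, [/\ V A, U B & has_triangle A B D]) /\
  (exists A B, [/\ V A, U B & has_triangle D A B]).
Proof.
move=> [_ [_ _ app1 app2] _] TD; split.
  by have [A [B [VA UB t]]] := app1 (exist _ D TD); exists (sval A), (sval B).
by have [A [B [VA UB t]]] := app2 (exist _ D TD); exists (sval A), (sval B).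
Qed.

Lemma cotorsion_subcategory U V :
  thick_cotorsion_pair EP (U, V) -> subcategory U /\ subcategory V.
Proof.
by move=> [[sU sV] [[subU subV] _ _ _] _]; split; apply: subcategory_of_in_Thick; eauto.
Qed.

Lemma cotorsion_left_perp U V D :
  thick_cotorsion_pair EP (U, V) -> Thick U D ->
  (forall B, V B -> ext_vanish D B) -> U D.
Proof.
move=> cot TD D0; have [[A [B [VA UB t]]] _] := cotorsion_approx cot TD.
exact: subcategory_splitr (cotorsion_subcategory cot).1 UB t (D0 _ VA).
Qed.

Lemma cotorsion_frobenius U V :
  enough_injectives C ->
  thick_cotorsion_pair EP (U, V) -> left_frobenius_pair EP (U, U `&` V).
Proof.
move=> EI cot; have [subU subV] := cotorsion_subcategory cot.
have UT : U `<=` Thick U by apply: sub_Thick.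
have extU : ext_closed U.
  move=> A B D t UA UD; apply: (cotorsion_left_perp cot).
    exact: Thick_ext_closed t (UT _ UA) (UT _ UD).
  move=> Y VY; apply: ext_middle_vanish t _ _; exact: cotorsion_vanish cot _ VY.
split=> //.
- split=> //; have [U0 Ub Ui Us] := subU; have [V0 Vb Vi Vs] := subV; split.
  + by move=> Z Z0; split; [apply: U0 | apply: V0].
  + by move=> A B P [UA VA] [UB VB]; split; [apply: Ub | apply: Vb].
  + by move=> A B f isof [UA VA]; split; [apply: Ui isof UA | apply: Vi isof VA].
  + by move=> A B P [UP VP]; split; [apply: Us UP | apply: Vs VP].
- split=> // A B D t UB UD; apply: (cotorsion_left_perp cot).
    exact: Thick_cocone_closed t (UT _ UB) (UT _ UD).
  move=> Y VY; have [P projP tP] := syzygy_triangle EP D.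
  have [_ _ sV] := cot.
  exact: cocone_ext_vanish EI projP tP t (sV _ VY D UD 1%N)
    (cotorsion_vanish cot UB VY).
- by move=> Y [_ VY]; case: cot => _ _; apply.
- move=> A UA; have [_ [B [D [VB UD t]]]] := cotorsion_approx cot (UT _ UA).
  by exists B, D; split=> //; split=> //; apply: extU t UA UD.
Qed.

Lemma frobenius_hat_cap X W : left_frobenius_pair EP (X, W) -> X `&` hat W = W.
Proof.
move=> frob; rewrite hatE; apply/seteqP; split=> A.
  by move=> [XA VA]; apply: XV_W frob _ XA VA.
by move=> WA; split; [case: frob => _ _ sWX _ _; apply: sWX | apply: resolved0].
Qed.

(** For A in V, the triangle A -> B -> D with B in V' and D in U splits. *)
Lemma cotorsion_right_sub U V V' :
  thick_cotorsion_pair EP (U, V) -> thick_cotorsion_pair EP (U, V') -> V `<=` V'.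
Proof.
move=> cot cot' A VA; have [[_ VT] _ _] := cot.
have [_ [B [D [VB UD t]]]] := cotorsion_approx cot' (VT _ VA).
exact: subcategory_split (cotorsion_subcategory cot').2 VB t
  (cotorsion_vanish cot UD VA).
Qed.

Lemma cotorsion_hat_cap U V :
  enough_injectives C -> thick_cotorsion_pair EP (U, V) -> hat (U `&` V) = V.
Proof.
move=> EI cot.
have cot' := frobenius_cotorsion (cotorsion_frobenius EI cot).
by apply/seteqP; split; apply: cotorsion_right_sub; eauto.
Qed.

End Correspondence.

Lemma set_bij_can (S T : Type) (A : set S) (B : set T) (f : S -> T) (g : T -> S) :
  set_fun A B f -> set_fun B A g -> {in A, cancel f g} -> {in B, cancel g f} ->
  set_bij A B f.
Proof. by move=> /Pfun[f' ->] /Pfun[g' ->]; apply: can2_bij. Qed.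

Theorem theorem3p12 (C : extriangulated_category)
    (EP : enough_projectives C) (EI : enough_injectives C) :
  let Frob : set (set C * set C) := left_frobenius_pair EP in
  let Cot : set (set C * set C) := thick_cotorsion_pair EP in
  let Phi (XW : set C * set C) := (XW.1, hat XW.2) in
  let Psi (UV : set C * set C) := (UV.1, UV.1 `&` UV.2) in
  [/\ set_bij Frob Cot Phi,
      set_bij Cot Frob Psi,
      {in Frob, cancel Phi Psi} &
      {in Cot, cancel Psi Phi}].
Proof.
move=> Frob Cot Phi Psi.
have PhiP : set_fun Frob Cot Phi by move=> [X W]; apply: frobenius_cotorsion.
have PsiP : set_fun Cot Frob Psi by move=> [U V]; apply: cotorsion_frobenius.
have PhiK : {in Frob, cancel Phi Psi}.
  by move=> [X W]; rewrite in_setE /Phi /Psi /= => /frobenius_hat_cap ->.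
have PsiK : {in Cot, cancel Psi Phi}.
  by move=> [U V]; rewrite in_setE /Phi /Psi /= => /(cotorsion_hat_cap EI) ->.
by split=> //; apply: set_bij_can; eauto.
Qed.
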